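(* Let $\{\mathsf{K}_t\}_{t=1}^\infty\subset\mathcal{C}_n$ be a sequence of policies that approaches (converges to) a boundary point $\mathsf{K}_\infty\in\partial\mathcal{C}_n$. If $\mathsf{K}_\infty=\begin{bmatrix}D_{\mathsf K_\infty}&C_{\mathsf K_\infty}\\ B_{\mathsf K_\infty}&A_{\mathsf K_\infty}\end{bmatrix}$ is minimal, i.e., $(A_{\mathsf K_\infty},B_{\mathsf K_\infty})$ is controllable and $(C_{\mathsf K_\infty},A_{\mathsf K_\infty})$ is observable, then $\lim_{t\to\infty}J_{\infty,n}(\mathsf{K}_t)=\infty$.
   Context: Plant data: integers $n,m,p\ge 1$, real matrices $A\in\mathbb{R}^{n\times n}$, $B\in\mathbb{R}^{n\times m}$, $C\in\mathbb{R}^{p\times n}$, and symmetric weights $Q\succeq 0$, $W\succeq 0$ ($n\times n$), $R\succ 0$ ($m\times m$), $V\succ 0$ ($p\times p$); $M^{1/2}$ is the symmetric positive semidefinite square root. Standing assumptions: $(A,B)$ and $(A,W^{1/2})$ are controllable, $(C,A)$ and $(Q^{1/2},A)$ are observable. A square matrix is stable if all its eigenvalues have strictly negative real parts. A dynamic policy of order $n$ is a matrix $\mathsf{K}=\begin{bmatrix}D_{\mathsf K} & C_{\mathsf K}\\ B_{\mathsf K} & A_{\mathsf K}\end{bmatrix}\in\mathbb{R}^{(m+n)\times(p+n)}$ with $A_{\mathsf K}\in\mathbb{R}^{n\times n}$, $B_{\mathsf K}\in\mathbb{R}^{n\times p}$, $C_{\mathsf K}\in\mathbb{R}^{m\times n}$,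 $D_{\mathsf K}\in\mathbb{R}^{m\times p}$. Define $$A_{\mathrm{cl}}(\mathsf K)=\begin{bmatrix}A+BD_{\mathsf K}C & BC_{\mathsf K}\\ B_{\mathsf K}C & A_{\mathsf K}\end{bmatrix},\quad B_{\mathrm{cl}}(\mathsf K)=\begin{bmatrix}W^{1/2}&BD_{\mathsf K}V^{1/2}\\ 0&B_{\mathsf K}V^{1/2}\end{bmatrix},$$ $$C_{\mathrm{cl}}(\mathsf K)=\begin{bmatrix}Q^{1/2}&0\\ R^{1/2}D_{\mathsf K}C&R^{1/2}C_{\mathsf K}\end{bmatrix},\quad D_{\mathrm{cl}}(\mathsf K)=\begin{bmatrix}0&0\\ 0&R^{1/2}D_{\mathsf K}V^{1/2}\end{bmatrix}.$$ $\mathcal{C}_n=\{\mathsf K\in\mathbb{R}^{(m+n)\times(p+n)}: A_{\mathrm{cl}}(\mathsf K)\text{ is stable}\}$, an open set with boundary $\partial\mathcal{C}_n$. The $\mathcal{H}_\infty$ cost is $J_{\infty,n}(\mathsf K)=\sup_{\omega\in\mathbb{R}}\sigma_{\max}\big(C_{\mathrm{cl}}(\mathsf K)(j\omega I-A_{\mathrm{cl}}(\mathsf K))^{-1}B_{\mathrm{cl}}(\mathsf K)+D_{\mathrm{cl}}(\mathsf K)\big)$ for $\mathsf K\in\mathcal{C}_n$, with $\sigma_{\max}$ the largest singular value. *)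

(* Defs.v *)
From HB Require Import structures.
From mathcomp Require Import all_boot all_order all_algebra.
From mathcomp Require Import complex.
From mathcomp Require Import all_classical all_reals all_analysis.
Set Implicit Arguments.
Unset Strict Implicit.
Unset Printing Implicit Defensive.
Import Order.TTheory GRing.Theory Num.Theory.
Import numFieldNormedType.Exports.
Local Open Scope classical_set_scope.
Local Open Scope complex_scope.
Local Open Scope ring_scope.

Definition boundary (T : topologicalType) (S : set T) : set T :=
  closure S `\` interior S.

Section Matrices.
Context {R : realType}.

Definition psdmx n (M : 'M[R]_n) : Prop :=
  M^T = M /\ forall x : 'cV[R]_n, 0 <= (x^T *m M *m x) 0 0.

Definition pdmx n (M : 'M[R]_n) : Prop :=
  M^T = M /\ forall x : 'cV[R]_n, x != 0 -> 0 < (x^T *m M *m x) 0 0.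

(* Every positive semidefinite M has exactly one positive semidefinite square
   root, so the choice made by xget is immaterial for such M. *)
Definition sqrtmx n (M : 'M[R]_n) : 'M[R]_n :=
  xget 0 [set S | psdmx S /\ S *m S = M].

(* Kalman rank conditions on [B AB ... A^(n-1)B] and its transpose analogue. *)
Definition controllable n m (A : 'M[R]_n) (B : 'M[R]_(n, m)) : Prop :=
  \rank (\mxrow_(i < n) (A ^+ i *m B)) = n.

Definition observable n p (C : 'M[R]_(p, n)) (A : 'M[R]_n) : Prop :=
  \rank (\mxcol_(i < n) (C *m A ^+ i)) = n.

Definition complexmx m n (M : 'M[R]_(m, n)) : 'M[R[i]]_(m, n) :=
  map_mx (real_complex R) M.

Definition stable n (A : 'M[R]_n) : Prop :=
  forall z : R[i], eigenvalue (complexmx A) z -> complex.Re z < 0.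

Definition singular_value m n (M : 'M[R[i]]_(m, n)) (s : R) : Prop :=
  0 <= s /\ eigenvalue (map_mx (@conjc R) M^T *m M) (s ^+ 2)%:C.

(* The set is finite, and nonempty as soon as n > 0: this sup is a maximum. *)
Definition sigma_max m n (M : 'M[R[i]]_(m, n)) : R :=
  sup [set s | singular_value M s].

Definition transfer n m p (A : 'M[R]_n) (B : 'M[R]_(n, m)) (C : 'M[R]_(p, n))
    (D : 'M[R]_(p, m)) (s : R[i]) : 'M[R[i]]_(p, m) :=
  complexmx C *m invmx (s%:M - complexmx A) *m complexmx B + complexmx D.

Definition hinf_norm n m p (A : 'M[R]_n) (B : 'M[R]_(n, m))
    (C : 'M[R]_(p, n)) (D : 'M[R]_(p, m)) : \bar R :=
  ereal_sup [set (sigma_max (transfer A B C D (0 +i* w)))%:E | w in [set: R]].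

End Matrices.

Section DynamicPolicies.
Context {R : realType} {n m p : nat}.

(* A policy is the block matrix [D_K, C_K; B_K, A_K]. *)
Notation policy := 'M[R]_(m + n, p + n).

Definition policyD (K : policy) : 'M[R]_(m, p) := ulsubmx K.
Definition policyC (K : policy) : 'M[R]_(m, n) := ursubmx K.
Definition policyB (K : policy) : 'M[R]_(n, p) := dlsubmx K.
Definition policyA (K : policy) : 'M[R]_n := drsubmx K.

Definition minimal_policy (K : policy) : Prop :=
  controllable (policyA K) (policyB K) /\ observable (policyC K) (policyA K).

(* Rw is the control weight "R"; the letter R is taken by the real numbers. *)
Variables (A : 'M[R]_n) (B : 'M[R]_(n, m)) (C : 'M[R]_(p, n)).
Variables (Q W : 'M[R]_n) (Rw : 'M[R]_m) (V : 'M[R]_p).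

Definition Acl (K : policy) : 'M[R]_(n + n) :=
  block_mx (A + B *m policyD K *m C) (B *m policyC K)
           (policyB K *m C)          (policyA K).

Definition Bcl (K : policy) : 'M[R]_(n + n, n + p) :=
  block_mx (sqrtmx W) (B *m policyD K *m sqrtmx V)
           0          (policyB K *m sqrtmx V).

Definition Ccl (K : policy) : 'M[R]_(n + m, n + n) :=
  block_mx (sqrtmx Q)                      0
           (sqrtmx Rw *m policyD K *m C)   (sqrtmx Rw *m policyC K).

Definition Dcl (K : policy) : 'M[R]_(n + m, n + p) :=
  block_mx 0 0
           0 (sqrtmx Rw *m policyD K *m sqrtmx V).

Definition stabilizing : set policy := [set K | stable (Acl K)].

Definition Jinf (K : policy) : \bar R :=
  hinf_norm (Acl K) (Bcl K) (Ccl K) (Dcl K).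

End DynamicPolicies.

(* Main.v *)
Require Import Defs.
From HB Require Import structures.
From mathcomp Require Import all_boot all_order all_algebra.
From mathcomp Require Import perm complex.
From mathcomp Require Import all_classical all_reals all_analysis.
From mathcomp Require Import ring lra.
Set Implicit Arguments.
Unset Strict Implicit.
Unset Printing Implicit Defensive.
Import Order.TTheory GRing.Theory Num.Theory.
Import numFieldNormedType.Exports.
Local Open Scope classical_set_scope.
Local Open Scope ring_scope.

(** Since stability is an open condition and each [K t] is stabilizing, a
boundary point [Kinf] has a closed loop matrix [A0] with an eigenvalue
[z = jw] on the imaginary axis ([boundary_eigenvalue]): an unstable
eigenvalue exists because [Kinf] is not interior, and its real part cannot be
positive because [A0] is a limit of stable matrices.  Both facts come from one
quantitative estimate on how far eigenvalues move ([eigenvalue_variation]).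

Only this frequency [w] matters: already the largest singular value of the
transfer matrix [T_t (jw)] tends to infinity, and it bounds the supremum over
all frequencies from below.  Minimality of [Kinf], together with
controllability of [(A, W^1/2)], observability of [(Q^1/2, A)] and
invertibility of [V^1/2] and [R^1/2], excludes that an eigenvector of [A0] is
annihilated by the limits [B0] or [H0] of the input and output matrices of the
closed loop ([closed_loop_controllable], [closed_loop_observable]).  Hence
[z - A0] can be inverted with the help of [B0] or of [H0]:
<<
  (z - A0) X' + B0 Y' = 1,      X (z - A0) + Y H0 = 1.
>>
For large [t] the same [X, Y, X', Y'] satisfy these identities up to a small
error with the matrices [A_t, B_t, H_t] of [K t].  So if
[H_t (z - A_t)^-1 B_t] were bounded, then [H_t (z - A_t)^-1] would be bounded
by the first identity, and then the resolvent [(z - A_t)^-1] itself by the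
second.  But a left eigenvector [v] of [A0] for [z] gives
[v = v (A0 - A_t) (z - A_t)^-1], where [A0 - A_t] tends to [0]: the resolvent
is unbounded ([transfer_diverges]).

All estimates use the entrywise l1 norm of complex matrices, which is
submultiplicative; [mxl1_le_sigma_max] compares it with the largest singular
value through the trace of [M^* M].  That the square roots of the positive
definite weights exist and are invertible is [sqrtmx_unit]. *)

(** * The entrywise l1 norm of complex matrices *)

Section Norm.
Context {R : realType}.
Local Notation C := R[i].
Local Notation normc := (@Normc.normc R).

Lemma normc_ge0 (x : C) : 0 <= normc x.
Proof. by case: x => a b; exact: sqrtr_ge0. Qed.

Lemma normc_sum (I : finType) (P : pred I) (f : I -> C) :
  normc (\sum_(i | P i) f i) <= \sum_(i | P i) normc (f i).
Proof.
elim/big_ind2 : _ => [|x a y b xa yb|//]; first by rewrite Normc.normc0.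
exact: le_trans (le_normcD _ _) (lerD xa yb).
Qed.

Lemma normc_prod (I : Type) (r : seq I) (P : pred I) (f : I -> C) :
  normc (\prod_(i <- r | P i) f i) = \prod_(i <- r | P i) normc (f i).
Proof. exact: (big_morph normc (@Normc.normcM R) (@Normc.normc1 R)). Qed.

Lemma normcX (x : C) k : normc (x ^+ k) = normc x ^+ k.
Proof. by elim: k => [|k IH]; rewrite ?expr0 ?Normc.normc1 // !exprS Normc.normcM IH. Qed.

Lemma normc_real (x : R) : normc (x%:C)%C = `|x|.
Proof. by rewrite /Normc.normc /= expr0n /= addr0 sqrtr_sqr. Qed.

Lemma Re_le_normc (x : C) : `|complex.Re x| <= normc x.
Proof.
case: x => a b /=; rewrite -sqrtr_sqr ler_sqrt ?lerDl ?sqr_ge0 //.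
by rewrite addr_ge0 ?sqr_ge0.
Qed.

Definition mxl1 a b (M : 'M[C]_(a, b)) : R := \sum_i \sum_j normc (M i j).

Lemma mxl1_ge0 a b (M : 'M[C]_(a, b)) : 0 <= mxl1 M.
Proof. by do 2![apply: sumr_ge0 => ? _]; exact: normc_ge0. Qed.

Lemma normc_le_mxl1 a b (M : 'M[C]_(a, b)) i j : normc (M i j) <= mxl1 M.
Proof.
rewrite /mxl1 (bigD1 i) //= (bigD1 j) //= -addrA lerDl addr_ge0 ?sumr_ge0 //.
  by move=> *; exact: normc_ge0.
by move=> *; apply: sumr_ge0 => *; exact: normc_ge0.
Qed.

Lemma mxl1_eq0 a b (M : 'M[C]_(a, b)) : mxl1 M = 0 -> M = 0.
Proof.
move=> M0; apply/matrixP => i j; rewrite mxE; apply: Normc.eq0_normc.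
by apply/eqP; rewrite eq_le normc_ge0 andbT -M0 normc_le_mxl1.
Qed.

Lemma mxl1_gt0 a b (M : 'M[C]_(a, b)) : M != 0 -> 0 < mxl1 M.
Proof.
by move=> M0; rewrite lt_def mxl1_ge0 andbT; apply: contra_neq M0; exact: mxl1_eq0.
Qed.

Lemma mxl1D a b (M N : 'M[C]_(a, b)) : mxl1 (M + N) <= mxl1 M + mxl1 N.
Proof.
rewrite -big_split; apply: ler_sum => i _; rewrite -big_split.
by apply: ler_sum => j _; rewrite mxE le_normcD.
Qed.

Lemma mxl1N a b (M : 'M[C]_(a, b)) : mxl1 (- M) = mxl1 M.
Proof. by do 2![apply: eq_bigr => ? _]; rewrite mxE normcN. Qed.

Lemma mxl1M a b c (M : 'M[C]_(a, b)) (N : 'M[C]_(b, c)) :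
  mxl1 (M *m N) <= mxl1 M * mxl1 N.
Proof.
rewrite /mxl1 mulr_suml; apply: ler_sum => i _.
apply: (@le_trans _ _ (\sum_j \sum_k normc (M i k) * normc (N k j))).
  apply: ler_sum => j _; rewrite mxE; apply: le_trans (normc_sum _ _) _.
  by apply: ler_sum => k _; rewrite Normc.normcM.
rewrite exchange_big mulr_suml; apply: ler_sum => k _ /=.
rewrite -mulr_sumr ler_wpM2l ?normc_ge0 // (bigD1 k) //= lerDl.
by do 2![apply: sumr_ge0 => *]; exact: normc_ge0.
Qed.

Lemma mxl1Z a b (z : C) (M : 'M[C]_(a, b)) : mxl1 (z *: M) = normc z * mxl1 M.
Proof.
rewrite /mxl1 mulr_sumr; apply: eq_bigr => i _; rewrite mulr_sumr.
by apply: eq_bigr => j _; rewrite mxE Normc.normcM.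
Qed.

Lemma mxl1_scalar n (z : C) : mxl1 (z%:M : 'M[C]_n) = normc z *+ n.
Proof.
rewrite -scalemx1 mxl1Z -mulr_natr; congr (_ * _).
rewrite /mxl1 (eq_bigr (fun=> 1)) ?sumr_const ?card_ord // => i _.
rewrite (bigD1 i) //= big1 => [|j ij]; rewrite mxE; last first.
  by rewrite eq_sym (negPf ij) mulr0n Normc.normc0.
by rewrite eqxx mulr1n Normc.normc1 addr0.
Qed.

Lemma mxl1_complexmx a b (M : 'M[R]_(a, b)) :
  mxl1 (complexmx M) = \sum_i \sum_j `|M i j|.
Proof. by do 2![apply: eq_bigr => ? _]; rewrite mxE normc_real. Qed.

Lemma complexmxB a b (M N : 'M[R]_(a, b)) :
  complexmx (M - N) = complexmx M - complexmx N.
Proof. exact: map_mxB. Qed.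

Lemma complexmxM a b c (M : 'M[R]_(a, b)) (N : 'M[R]_(b, c)) :
  complexmx (M *m N) = complexmx M *m complexmx N.
Proof. exact: map_mxM. Qed.

Lemma complexmxD a b (M N : 'M[R]_(a, b)) :
  complexmx (M + N) = complexmx M + complexmx N.
Proof. exact: map_mxD. Qed.

Lemma complexmx_tr a b (M : 'M[R]_(a, b)) : complexmx M^T = (complexmx M)^T.
Proof. by rewrite /complexmx map_trmx. Qed.

(** Each cofactor is a signed sum of products of entries of [M]; bounding the
entries by [1 + mxl1 M >= 1] lets every product be completed to [n] factors. *)
Lemma mxl1_adj n (M : 'M[C]_n) :
  mxl1 (\adj M) <= (n * n * n`!)%:R * (1 + mxl1 M) ^+ n.
Proof.
have M1 : 0 <= 1 + mxl1 M by rewrite addr_ge0 ?mxl1_ge0.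
have adj_ij i j : normc (\adj M i j) <= n`!%:R * (1 + mxl1 M) ^+ n.
  rewrite mxE expand_cofactor; apply: le_trans (normc_sum _ _) _.
  apply: (@le_trans _ _ (\sum_(s : 'S_n) (1 + mxl1 M) ^+ n)); last first.
    by rewrite sumr_const card_Sn mulr_natl.
  rewrite big_mkcond; apply: ler_sum => s _; case: ifP => _; last exact: exprn_ge0.
  rewrite Normc.normcM normcX normcN Normc.normc1 expr1n mul1r normc_prod.
  have -> : (1 + mxl1 M) ^+ n = \prod_(k < n) (1 + mxl1 M).
    by rewrite prodr_const card_ord.
  rewrite big_mkcond; apply: ler_prod => k _ /=.
  case: ifP => _; first by rewrite normc_ge0 /= ler_wpDl // normc_le_mxl1.
  by rewrite ler01 lerDl mxl1_ge0.
apply: (@le_trans _ _ (\sum_(i < n) \sum_(j < n) (n`!%:R * (1 + mxl1 M) ^+ n))).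
  by do 2![apply: ler_sum => ? _]; exact: adj_ij.
by rewrite !sumr_const !card_ord -mulrnA -[leLHS]mulr_natl mulrA -natrM.
Qed.

(** * Eigenvalues under perturbation *)

Lemma normc_eigenvalue n (A : 'M[C]_n) z : eigenvalue A z -> normc z <= mxl1 A.
Proof.
case/eigenvalueP=> v vA /mxl1_gt0 v0.
by rewrite -(ler_pM2r v0) -mxl1Z -vA mulrC; exact: mxl1M.
Qed.

Lemma det_eigenvalues n (A : 'M[C]_n) : exists r : seq C,
  [/\ size r = n, char_poly A = \prod_(l <- r) ('X - l%:P),
      forall l, (l \in r) = eigenvalue A l &
      forall z, \det (z%:M - A) = \prod_(l <- r) (z - l)].
Proof.
have [r Ar] := closed_field_poly_normal (char_poly A).
rewrite (monicP (char_poly_monic A)) scale1r in Ar.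
exists r; split => //.
- by apply: succn_inj; rewrite -(size_char_poly A) Ar size_prod_XsubC.
- by move=> l; rewrite eigenvalue_root_char Ar root_prod_XsubC.
move=> z; have := congr1 (fun p => p.[z]) Ar.
rewrite horner_prod; under eq_bigr do rewrite !hornerE.
move<-; rewrite /char_poly -horner_evalE -det_map_mx; congr (\det _).
by apply/matrixP => i j; rewrite !mxE /= horner_evalE !hornerE hornerMn hornerX.
Qed.

(** With [v A = z v] one has
[det(z - B) v = v (z - B) adj(z - B) = v (A - B) adj(z - B)], while
[det(z - B)] is the product of the [z - l] over the eigenvalues [l] of [B], so
that its modulus is at least [d ^+ n].  The estimate is used in both
directions: [A] the limit and [B] an approximant, and conversely. *)
Lemma eigenvalue_variation n (A B : 'M[C]_n) z d : eigenvalue A z -> 0 <= d ->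
  (forall l, eigenvalue B l -> d <= normc (z - l)) ->
  d ^+ n <= mxl1 (A - B) * ((n * n * n`!)%:R * (1 + mxl1 (z%:M - B)) ^+ n).
Proof.
move=> /eigenvalueP[v vA /mxl1_gt0 v0] d0 dB.
have [r [sr _ rB detE]] := det_eigenvalues B.
have dn : d ^+ n <= normc (\det (z%:M - B)).
  rewrite detE normc_prod -sr -[size r]card_ord -prodr_const (big_nth 0) big_mkord.
  by apply: ler_prod => i _; rewrite d0 dB // -rB mem_nth.
rewrite -(ler_pM2l v0); apply: (@le_trans _ _ (mxl1 v * normc (\det (z%:M - B)))).
  by rewrite ler_wpM2l ?mxl1_ge0.
rewrite mulrC -mxl1Z -mul_mx_scalar -mul_mx_adj mulmxA.
have -> : v *m (z%:M - B) = v *m (A - B).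
  by rewrite !mulmxBr mul_mx_scalar vA.
apply: le_trans (mxl1M _ _) _; rewrite (mulrA (mxl1 v)).
by apply: ler_pM; rewrite ?mxl1_ge0 ?mxl1M ?mxl1_adj.
Qed.

End Norm.

Section Stab.
Context {R : realType}.
Local Notation normc := (@Normc.normc R).
Context (T : Type) (F : set_system T).

(** An eigenvalue of [L] with positive real part would stay at distance at
least [Re z] from the spectra of the stable matrices [A t], which the
variation estimate forbids once [A t] is close to [L]. *)
Lemma Re_eigenvalue_limit {FF : ProperFilter F} n (A : T -> 'M[R]_n) L z :
  mxl1 (complexmx (A t - L)) @[t --> F] --> 0 ->
  (\forall t \near F, stable (A t)) -> eigenvalue (complexmx L) z ->
  complex.Re z <= 0.
Proof.
move=> AL stA Lz; rewrite leNgt; apply/negP => z0.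
pose K := (n * n * n`!)%:R * (2 + mxl1 (z%:M - complexmx L)) ^+ n.
have K0 : 0 <= K by rewrite mulr_ge0 ?exprn_ge0 // addr_ge0 ?mxl1_ge0.
have e0 : 0 < complex.Re z ^+ n / (K + 1) by rewrite divr_gt0 ?exprn_gt0 ?ltr_wpDl.
have [t [[At lt1] lte]] := filter_ex (filterI (filterI stA (cvgr_lt _ AL _ ltr01))
  (cvgr_lt _ AL _ e0)).
have dA l : eigenvalue (complexmx (A t)) l -> complex.Re z <= normc (z - l).
  move=> /At l0; apply: le_trans (Re_le_normc _).
  rewrite raddfB /= ger0_norm ?subr_ge0; last by rewrite ltW // (lt_trans l0).
  by rewrite lerBrDl gerDr ltW.
have := eigenvalue_variation Lz (ltW z0) dA; apply/negP; rewrite -ltNge.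
have eN : mxl1 (complexmx L - complexmx (A t)) = mxl1 (complexmx (A t - L)).
  by rewrite complexmxB -mxl1N opprB.
rewrite eN; move: lte; rewrite ltr_pdivlMr ?ltr_wpDl //; apply: le_lt_trans.
apply: ler_wpM2l; first exact: mxl1_ge0.
apply: (@le_trans _ _ K); last by rewrite lerDl.
apply: ler_wpM2l => //; apply: lerXn2r; rewrite ?nnegrE ?addr_ge0 ?mxl1_ge0 //.
have -> : z%:M - complexmx (A t) = (z%:M - complexmx L) + (complexmx L - complexmx (A t)).
  by rewrite addrA subrK.
have := mxl1D (z%:M - complexmx L) (complexmx L - complexmx (A t)); rewrite eN.
by lra.
Qed.

(** Stability is an open condition: the finitely many eigenvalues of [L] have
real part at most some [- d < 0], so an eigenvalue of [A t] in the closed right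
half plane would be at distance at least [d] from all of them.  Such an
eigenvalue is bounded by the norm of [A t], which makes the constant of the
variation estimate uniform. *)
Lemma stable_near {FF : Filter F} n (A : T -> 'M[R]_n) L :
  mxl1 (complexmx (A t - L)) @[t --> F] --> 0 -> stable L ->
  \forall t \near F, stable (A t).
Proof.
move=> AL stL.
have [r [_ _ rL _]] := det_eigenvalues (complexmx L).
have [d d0 dr] : exists2 d, 0 < d & forall l, l \in r -> complex.Re l <= - d.
  have : forall l, l \in r -> complex.Re l < 0 by move=> l; rewrite rL => /stL.
  elim: {rL} r => [_|x r IH xr]; first by exists 1.
  have [|d d0 dr] := IH; first by move=> l lr; apply: xr; rewrite inE lr orbT.
  exists (Num.min d (- complex.Re x)); first by rewrite lt_min d0 oppr_gt0 xr ?mem_head.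
  move=> l; rewrite inE lerNr ge_min => /orP[/eqP->|/dr]; rewrite ?lexx ?orbT //.
  by rewrite lerNr => ->.
pose b := mxl1 (complexmx L) + 1.
pose K := (n * n * n`!)%:R * (1 + (b *+ n + mxl1 (complexmx L))) ^+ n.
have b0 : 0 <= b by rewrite addr_ge0 ?mxl1_ge0.
have K0 : 0 <= K by rewrite mulr_ge0 ?exprn_ge0 // !addr_ge0 ?mulrn_wge0 ?mxl1_ge0.
have e0 : 0 < d ^+ n / (K + 1) by rewrite divr_gt0 ?exprn_gt0 ?ltr_wpDl.
apply: filterS (filterI (cvgr_lt _ AL _ ltr01) (cvgr_lt _ AL _ e0)) => t [lt1 lte] z Az.
rewrite ltNge; apply/negP => z0.
have dL l : eigenvalue (complexmx L) l -> d <= normc (z - l).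
  rewrite -rL => /dr ld; apply: le_trans (Re_le_normc _); rewrite raddfB /=.
  by apply: le_trans (ler_norm _); lra.
have := eigenvalue_variation Az (ltW d0) dL; apply/negP; rewrite -ltNge -complexmxB.
move: lte; rewrite ltr_pdivlMr ?ltr_wpDl //; apply: le_lt_trans.
apply: ler_wpM2l; first exact: mxl1_ge0.
apply: (@le_trans _ _ K); last by rewrite lerDl.
apply: ler_wpM2l => //.
apply: lerXn2r; rewrite ?nnegrE ?addr_ge0 ?mulrn_wge0 ?mxl1_ge0 //.
rewrite lerD2l; apply: le_trans (mxl1D _ _) _; rewrite mxl1N lerD2r mxl1_scalar.
rewrite lerMn2r; apply/orP; right; apply: le_trans (normc_eigenvalue Az) _.
rewrite -(subrK (complexmx L) (complexmx (A t))) -complexmxB.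
by apply: le_trans (mxl1D _ _) _; rewrite addrC lerD2l ltW.
Qed.

End Stab.

(** * Square roots of positive semidefinite matrices *)

Section Sqrt.
Context {R : realType}.

Lemma interpolation (K : fieldType) (f : K -> K) (s : seq K) :
  exists p : {poly K}, forall x, x \in s -> p.[x] = f x.
Proof.
elim: s => [|a s [p ps]]; first by exists 0.
have [as_|as_] := boolP (a \in s).
  by exists p => x; rewrite inE => /orP[/eqP->|]; exact: ps.
pose w := \prod_(b <- s) ('X - b%:P); have wa : w.[a] != 0.
  by rewrite -[_ == 0]/(root w a) root_prod_XsubC.
exists (p + ((f a - p.[a]) / w.[a]) *: w) => x; rewrite inE !hornerE.
move=> /orP[/eqP->|xs]; first by rewrite divfK // addrC subrK.
have /rootP -> : root w x by rewrite root_prod_XsubC.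
by rewrite mulr0 addr0 ps.
Qed.

Lemma trmx_horner_mx n (V : 'M[R]_n.+1) (q : {poly R}) :
  V^T = V -> (horner_mx V q)^T = horner_mx V q.
Proof.
move=> Vsym; elim/poly_ind: q => [|q c IH]; first by rewrite rmorph0 trmx0.
rewrite rmorphD rmorphM /= horner_mx_X horner_mx_C raddfD /= tr_scalar_mx.
congr (_ + _); rewrite -mulmxE trmx_mul IH Vsym.
exact: comm_mx_horner.
Qed.

Lemma psd_eigenvalue_ge0 n (V : 'M[R]_n) l : psdmx V -> eigenvalue V l -> 0 <= l.
Proof.
move=> [_ Vpos] /eigenvalueP[v vV v0].
have := Vpos v^T; rewrite trmxK vV -scalemxAl mxE.
have vv : (v *m v^T) 0 0 = \sum_j v 0 j ^+ 2.
  by rewrite mxE; apply: eq_bigr => j _; rewrite mxE expr2.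
suff : 0 < (v *m v^T) 0 0 by move=> /pmulr_lge0->.
rewrite lt_def vv sumr_ge0 ?andbT => [|j _]; last exact: sqr_ge0.
apply: contra_neq v0 => /psumr_eq0P vj0; apply/rowP => j; rewrite mxE.
by apply/eqP; rewrite -sqrf_eq0 vj0 // => k _; exact: sqr_ge0.
Qed.

(** The diagonalizing matrix [P] is complex, being provided by the spectral
theorem for Hermitian matrices; only the eigenvalues are claimed to be
real. *)
Lemma symmetric_diagonalization n (V : 'M[R]_n) : V^T = V ->
  exists P (d : 'rV[R]_n), [/\ P \in unitmx,
    complexmx V = invmx P *m diag_mx (complexmx d) *m P &
    forall i, eigenvalue V (d 0 i)].
Proof.
move=> Vsym; set cV := complexmx V.
have cVreal : cV \is a mxOver Num.real.
  by apply/mxOverP => i j; rewrite mxE complex_real.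
have cVsym : cV \is symmetricmx.
  by apply/is_hermitianmxP; rewrite expr0 scale1r map_mx_id // map_trmx Vsym.
have cVH := realsym_hermsym cVsym cVreal.
have /orthomx_spectralP cVE := hermitian_normalmx cVH.
have dreal := hermitian_spectral_diag_real cVH.
have Pu := spectral_unit cV.
move: (spectralmx cV) (spectral_diag cV) Pu dreal cVE => P d Pu dreal cVE.
have dE : d = complexmx (map_mx (@complex.Re R) d).
  apply/rowP => i; rewrite !mxE /= RRe_real //.
  by move/mxOverP : dreal; apply.
exists P, (map_mx (@complex.Re R) d); rewrite -dE; split => // i.
rewrite -(eigenvalue_map (real_complex R)) -/(complexmx V) -/cV.
rewrite [X in eigenvalue _ X](_ : _ = d 0 i); last by rewrite [in RHS]dE !mxE.
apply/eigenvalueP; exists (row i P).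
  by rewrite -row_mul cVE -mulmxA mulKVmx // mul_diag_mx; apply/rowP => j; rewrite !mxE.
apply: contraTneq Pu => Pi0; rewrite -row_free_unit.
by apply/row_freePn; exists i; rewrite Pi0 sub0mx.
Qed.

(** A polynomial in [V] that interpolates the square root on the spectrum of
[V] is a real matrix although the diagonalization is complex.  Interpolating
the fourth root instead gives a symmetric [T] with [T ^+ 4 = V], whose square
is visibly positive semidefinite. *)
Lemma psd_sqrt n (V : 'M[R]_n) : psdmx V -> exists S, psdmx S /\ S *m S = V.
Proof.
case: n V => [|n] V Vpsd.
  by exists V; split => //; rewrite !(flatmx0 V) mul0mx.
have [P [d [Pu VE dV]]] := symmetric_diagonalization Vpsd.1.
have [q qd] := interpolation (fun x => Num.sqrt (Num.sqrt x)) (codom (fun i => d 0 i)).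
pose T := horner_mx V q.
have Tsym : T^T = T by apply: trmx_horner_mx; exact: Vpsd.1.
have T4 : (T * T) * (T * T) = V.
  rewrite /T -!rmorphM /=; apply: (@map_mx_inj _ _ (real_complex R)).
  rewrite map_horner_mx -/(complexmx V) VE -[X in invmx P *m _ *m X]invmxK.
  rewrite horner_mx_uconj ?unitmx_inv // horner_mx_diag invmxK -[in LHS]map_mx_comp.
  congr (_ *m diag_mx _ *m _); apply/rowP => i; rewrite !mxE.
  rewrite /= horner_map /= !hornerM qd; last exact: (codom_f (fun i => d 0 i)).
  congr (real_complex R _).
  by rewrite -!expr2 !sqr_sqrtr ?sqrtr_ge0 // (psd_eigenvalue_ge0 Vpsd).
exists (T *m T); split => //; split; first by rewrite trmx_mul Tsym.
move=> x; rewrite mulmxA -mulmxA -{1}Tsym -trmx_mul mxE.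
by apply: sumr_ge0 => i _; rewrite [X in X * _]mxE -expr2 sqr_ge0.
Qed.

Lemma sqrtmx_unit n (V : 'M[R]_n) : pdmx V -> sqrtmx V \in unitmx.
Proof.
move=> [Vsym Vpos].
have Vpsd : psdmx V.
  split=> // x; have [->|/Vpos/ltW//] := eqVneq x 0.
  by rewrite mulmx0 mxE.
have [S SP] := psd_sqrt Vpsd.
have [_ sqV] : psdmx (sqrtmx V) /\ sqrtmx V *m sqrtmx V = V.
  by rewrite /sqrtmx; case: xgetP => [y _ []|/(_ S)//].
suff : V \in unitmx by rewrite -{1}sqV unitmx_mul => /andP[].
rewrite -row_free_unit -kermx_eq0; apply/eqP/row_matrixP => i; rewrite row0.
set v := row i _; apply/eqP/negPn/negP => v0.
have vV : v *m V = 0 by rewrite -row_mul mulmx_ker row0.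
by have := Vpos v^T; rewrite trmx_eq0 v0 trmxK vV mul0mx mxE ltxx => /(_ isT).
Qed.

End Sqrt.

(** * Eigenvector tests for controllability and observability *)

Section PBH.
Context {R : realType}.
Local Notation C := R[i].

(** On a left eigenvector [v] of [A], [v A^k B = z^k v B]; if this vanishes for
all [k], then [v] is in the left kernel of the Kalman matrix. *)
Lemma controllable_eigenvector n m (A : 'M[R]_n) (B : 'M[R]_(n, m)) z (v : 'rV[C]_n) :
  controllable A B -> v *m complexmx A = z *: v -> v *m complexmx B = 0 -> v = 0.
Proof.
move=> AB vA vB.
have free : row_free (complexmx (\mxrow_(i < n) (A ^+ i *m B))).
  by rewrite /row_free mxrank_map AB.
apply: (row_free_inj free); rewrite mul0mx.
have vAi k : v *m complexmx (A ^+ k *m B) = 0.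
  rewrite complexmxM mulmxA; elim: k => [|k IH].
    by rewrite expr0 /complexmx map_mx1 mulmx1.
  by rewrite exprS -mulmxE complexmxM mulmxA vA -!scalemxAl IH scaler0.
apply/rowP => j; rewrite [RHS]mxE.
have <- : (v *m complexmx (A ^+ tagnat.sig1 j *m B)) 0 (tagnat.sig2 j) = 0.
  by rewrite vAi mxE.
by rewrite !mxE; apply: eq_bigr => k _; rewrite !mxE.
Qed.

Lemma trmx_expr n (A : 'M[R]_n) k : (A ^+ k)^T = A^T ^+ k.
Proof.
elim: k => [|k IH]; first by rewrite !expr0 trmx1.
by rewrite exprS exprSr -!mulmxE trmx_mul IH.
Qed.

Lemma observable_tr n p (A : 'M[R]_n) (B : 'M[R]_(p, n)) :
  observable B A -> controllable A^T B^T.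
Proof.
rewrite /observable /controllable -mxrank_tr tr_mxcol => rkn; rewrite -[RHS]rkn.
by congr mxrank; apply: eq_mxrow => i; rewrite trmx_mul trmx_expr.
Qed.

Lemma observable_eigenvector n p (A : 'M[R]_n) (B : 'M[R]_(p, n)) z (v : 'cV[C]_n) :
  observable B A -> complexmx A *m v = z *: v -> complexmx B *m v = 0 -> v = 0.
Proof.
move=> /observable_tr AB Av Bv; apply: trmx_inj; rewrite trmx0.
apply: (controllable_eigenvector AB (z := z)).
  by rewrite complexmx_tr -trmx_mul Av linearZ.
by rewrite complexmx_tr -trmx_mul Bv trmx0.
Qed.

Lemma right_inverse n m (A : 'M[C]_n) (B : 'M[C]_(n, m)) z :
  (forall v : 'rV_n, v *m A = z *: v -> v *m B = 0 -> v = 0) ->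
  exists X Y, (z%:M - A) *m X + B *m Y = 1%:M.
Proof.
move=> AB; have : row_free (row_mx (z%:M - A) B).
  rewrite -kermx_eq0; apply/eqP/row_matrixP => i; rewrite row0.
  have : row i (kermx (row_mx (z%:M - A) B)) *m row_mx (z%:M - A) B = 0.
    by rewrite -row_mul mulmx_ker row0.
  rewrite mul_mx_row -[X in _ = X]row_mx0 => /eq_row_mx[vA vB].
  apply: AB => //; apply/esym/eqP; rewrite -subr_eq0 -mul_mx_scalar -mulmxBr.
  exact/eqP.
case/row_freeP => X; rewrite -[X]vsubmxK mul_row_col => E.
by exists (usubmx X), (dsubmx X).
Qed.

Lemma left_inverse n p (A : 'M[C]_n) (B : 'M[C]_(p, n)) z :
  (forall v : 'cV_n, A *m v = z *: v -> B *m v = 0 -> v = 0) ->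
  exists X Y, X *m (z%:M - A) + Y *m B = 1%:M.
Proof.
move=> AB; have [|X [Y XY]] := @right_inverse n p A^T B^T z.
  move=> v vA vB; apply: trmx_inj; rewrite trmx0; apply: AB.
    by rewrite -[A]trmxK -trmx_mul vA linearZ.
  by rewrite -[B]trmxK -trmx_mul vB trmx0.
exists X^T, Y^T; apply: trmx_inj; rewrite trmx1 -XY.
by rewrite raddfD /= !trmx_mul !trmxK raddfB /= tr_scalar_mx.
Qed.

Context {n m p : nat}.
Variables (A : 'M[R]_n) (B : 'M[R]_(n, m)) (D : 'M[R]_(p, n)).
Variables (Q W : 'M[R]_n) (Rw : 'M[R]_m) (V : 'M[R]_p) (K : 'M[R]_(m + n, p + n)).

(** Write [v = (v1, v2)].  Cancelling [V^1/2] in the second condition yields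
[v1 B D_K + v2 B_K = 0], which removes the feedback terms from the first block
of the eigenvector equation: [v1] is a left eigenvector of [A] itself and is
killed by [W^1/2].  So [v1 = 0], and the remaining equations say the same of
[v2] and the pair [(A_K, B_K)]. *)
Lemma closed_loop_controllable z (v : 'rV[C]_(n + n)) :
  controllable A (sqrtmx W) -> sqrtmx V \in unitmx ->
  controllable (policyA K) (policyB K) ->
  v *m complexmx (Acl A B D K) = z *: v ->
  v *m complexmx (Bcl B W V K) = 0 -> v = 0.
Proof.
move=> AW Vu ABK; rewrite -[v]hsubmxK; move: (lsubmx v) (rsubmx v) => v1 v2.
rewrite /complexmx !map_block_mx !mul_row_block map_mx0 mulmx0 addr0 scale_row_mx.
rewrite -[X in _ -> _ = X -> _]row_mx0 -!/(complexmx _).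
move=> /eq_row_mx[+ +] /eq_row_mx[v1W].
rewrite !complexmxD !complexmxM !mulmxA -!mulmxDl => vA1 vA2 vV.
have vBD : v1 *m complexmx B *m complexmx (policyD K) + v2 *m complexmx (policyB K) = 0.
  apply: (row_free_inj (A := complexmx (sqrtmx V))); last by rewrite mul0mx.
  by rewrite row_free_unit map_unitmx.
have v10 : v1 = 0.
  apply: (controllable_eigenvector AW _ v1W (z := z)); rewrite -vA1 mulmxDr.
  by rewrite !mulmxA -addrA -mulmxDl vBD mul0mx addr0.
move: vBD vA2; rewrite v10 !mul0mx !add0r => vB vA.
by rewrite (controllable_eigenvector ABK vA vB) row_mx0.
Qed.

(** Dual to [closed_loop_controllable]: the cancelled term is now the control
signal [D_K C v1 + C_K v2]. *)
Lemma closed_loop_observable z (v : 'cV[C]_(n + n)) :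
  observable (sqrtmx Q) A -> sqrtmx Rw \in unitmx ->
  observable (policyC K) (policyA K) ->
  complexmx (Acl A B D K) *m v = z *: v ->
  complexmx (Ccl D Q Rw K) *m v = 0 -> v = 0.
Proof.
move=> AQ Ru ACK; rewrite -[v]vsubmxK; move: (usubmx v) (dsubmx v) => v1 v2.
rewrite /complexmx !map_block_mx !mul_block_col map_mx0 mul0mx addr0 scale_col_mx.
rewrite -[X in _ -> _ = X -> _]col_mx0 -!/(complexmx _).
move=> /eq_col_mx[+ +] /eq_col_mx[Qv1].
rewrite !complexmxD !complexmxM -!mulmxA -!mulmxDr => vA1 vA2 vR.
have vCD : complexmx (policyD K) *m (complexmx D *m v1) + complexmx (policyC K) *m v2 = 0.
  have Rcu : complexmx (sqrtmx Rw) \in unitmx by rewrite map_unitmx.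
  by rewrite -[LHS](mulKmx Rcu) vR mulmx0.
have v10 : v1 = 0.
  apply: (observable_eigenvector AQ _ Qv1 (z := z)); rewrite -vA1 mulmxDl.
  by rewrite -!mulmxA -addrA -mulmxDr vCD mulmx0 addr0.
move: vCD vA2; rewrite v10 !mulmx0 !add0r => vC vA.
by rewrite (observable_eigenvector ACK vA vC) col_mx0.
Qed.

End PBH.

(** * Resolvent bounds from approximate one-sided inverses *)

Section Bounds.
Context {R : realType}.
Local Notation C := R[i].

(** Multiplying [X M + Y H = 1 + E] by [F = M^-1] gives [F = X + Y (H F) - E F],
and [E F] costs at most half of the norm of [F]. *)
Lemma mxl1_invmx_le n p (M X : 'M[C]_n) (Y : 'M[C]_(n, p)) (H : 'M[C]_(p, n)) :
  M \in unitmx -> mxl1 (X *m M + Y *m H - 1%:M) <= 2^-1 ->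
  mxl1 (invmx M) <= 2 * (mxl1 X + mxl1 Y * mxl1 (H *m invmx M)).
Proof.
set E := _ - _ => Mu E2; set F := invmx M.
have : F = X + Y *m (H *m F) - E *m F.
  by rewrite /E mulmxBl mulmxDl mulmxK // mul1mx mulmxA opprB addrC subrK.
move=> /(congr1 (@mxl1 R _ _)) FE.
have : mxl1 F <= mxl1 X + mxl1 Y * mxl1 (H *m F) + 2^-1 * mxl1 F.
  rewrite {1}FE; apply: le_trans (mxl1D _ _) (lerD _ _).
    by apply: le_trans (mxl1D _ _) (lerD _ (mxl1M _ _)).
  by rewrite mxl1N; apply: le_trans (mxl1M _ _) _; rewrite ler_wpM2r ?mxl1_ge0.
by lra.
Qed.

Lemma mxl1_mul_invmx_le n m p (M X : 'M[C]_n) (Y : 'M[C]_(m, n)) (G : 'M[C]_(n, m))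
    (H : 'M[C]_(p, n)) :
  M \in unitmx -> mxl1 (M *m X + G *m Y - 1%:M) <= 2^-1 ->
  mxl1 (H *m invmx M) <= 2 * (mxl1 H * mxl1 X + mxl1 (H *m invmx M *m G) * mxl1 Y).
Proof.
set E := _ - _ => Mu E2; set F := H *m invmx M.
have : F = H *m X + F *m G *m Y - F *m E.
  by rewrite /E mulmxBr mulmxDr mulmx1 !mulmxA {2}/F mulmxKV // opprB addrC subrK.
move=> /(congr1 (@mxl1 R _ _)) FE.
have : mxl1 F <= mxl1 H * mxl1 X + mxl1 (F *m G) * mxl1 Y + mxl1 F * 2^-1.
  rewrite {1}FE; apply: le_trans (mxl1D _ _) (lerD _ _).
    by apply: le_trans (mxl1D _ _) (lerD (mxl1M _ _) (mxl1M _ _)).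
  by rewrite mxl1N; apply: le_trans (mxl1M _ _) _; rewrite ler_wpM2l ?mxl1_ge0.
by lra.
Qed.

End Bounds.

(** * The largest singular value *)

Section Sigma.
Context {R : realType}.
Local Notation C := R[i].
Local Notation normc := (@Normc.normc R).
Local Notation "M ^H" := (map_mx (@conjc R) M^T) (at level 8).

Lemma sqr_normcC (x : C) : ((normc x ^+ 2)%:C)%C = x * conjc x.
Proof. by rewrite -sqr_normc normc_def rmorphXn /=; case: x. Qed.

Lemma dot_conj n (v : 'rV[C]_n) :
  (v *m v^H) 0 0 = ((\sum_j normc (v 0 j) ^+ 2)%:C)%C.
Proof.
by rewrite mxE rmorph_sum; apply: eq_bigr => j _; rewrite !mxE /= sqr_normcC.
Qed.

Lemma gram_eigenvalue_ge0 m n (M : 'M[C]_(m, n)) l :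
  eigenvalue (M^H *m M) l -> 0 <= l.
Proof.
case/eigenvalueP=> v vH v0.
have vv0 : 0 < \sum_j normc (v 0 j) ^+ 2.
  rewrite lt_def sumr_ge0 ?andbT => [|j _]; last exact: sqr_ge0.
  apply: contra_neq v0 => /psumr_eq0P vj0; apply/rowP => j; rewrite mxE.
  apply: Normc.eq0_normc; apply/eqP; rewrite -sqrf_eq0 vj0 // => k _; exact: sqr_ge0.
have E : v *m (M^H *m M) *m v^H = (v *m M^H) *m (v *m M^H)^H.
  rewrite trmx_mul map_mxM !mulmxA; congr (_ *m _ *m _).
  by apply/matrixP => i j; rewrite !mxE; exact: (esym (conjcK _)).
have := congr1 (fun X : 'M[C]_1 => X 0 0) E.
rewrite vH -scalemxAl mxE !dot_conj => lE.
have : 0 <= l * ((\sum_j normc (v 0 j) ^+ 2)%:C)%C.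
  by rewrite lE lecR sumr_ge0 // => *; exact: sqr_ge0.
by rewrite pmulr_lge0 // ltcR.
Qed.

(** The squared moduli of the entries of [M] sum up to the trace of [M^* M],
that is, to the sum of its [n] eigenvalues, each of which is the square of a
singular value. *)
Lemma normc_le_sigma_max m n (M : 'M[C]_(m, n)) i j :
  normc (M i j) <= n%:R * sigma_max M.
Proof.
have n1 : (0 < n)%N by case: n j {M} => // -[].
set H := M^H *m M.
have ubM : has_ubound [set s | singular_value M s].
  (* [s ^+ 2 <= mxl1 H] implies [s <= 1 + mxl1 H] without a square root. *)
  exists (1 + mxl1 H) => s [s0 /normc_eigenvalue].
  rewrite normc_real ger0_norm ?sqr_ge0 // -/H => s2; rewrite leNgt; apply/negP => s1.
  by have := mxl1_ge0 H; nra.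
have sM (l : C) : eigenvalue H l ->
    singular_value M (Num.sqrt (complex.Re l)) /\ complex.Re l <= sigma_max M ^+ 2.
  move=> Hl; have := gram_eigenvalue_ge0 Hl; rewrite lecE /= => /andP[/eqP l0 l1].
  have lE : l = ((complex.Re l)%:C)%C by case: (l) l0 => a b /= ->.
  have sv : singular_value M (Num.sqrt (complex.Re l)).
    split; first exact: sqrtr_ge0.
    by rewrite (sqr_sqrtr l1) -lE.
  split => //; rewrite -(sqr_sqrtr l1).
  have lS := ub_le_sup ubM sv.
  by apply: lerXn2r; rewrite ?nnegrE ?sqrtr_ge0 // (le_trans (sqrtr_ge0 _) lS).
have [r [sr rE rH _]] := det_eigenvalues H.
have trE : \tr H = \sum_(l <- r) l.
  apply: oppr_inj; rewrite -char_poly_trace // rE -sr coefPn_prod_XsubC //.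
  by rewrite sr -lt0n.
have trM : \tr H = ((\sum_k \sum_l normc (M l k) ^+ 2)%:C)%C.
  rewrite rmorph_sum; apply: eq_bigr => k _; rewrite mxE rmorph_sum.
  by apply: eq_bigr => l _; rewrite !mxE /= sqr_normcC mulrC.
have s0 : 0 <= sigma_max M.
  have [|s0] := boolP (r == [::]); first by rewrite -size_eq0 sr (gtn_eqF n1).
  have /sM[sv _] : eigenvalue H (head 0 r).
    by rewrite -rH; case: (r) s0 => // ? ? _; exact: mem_head.
  exact: le_trans (sqrtr_ge0 _) (ub_le_sup ubM sv).
have : normc (M i j) ^+ 2 <= n%:R * sigma_max M ^+ 2.
  apply: (@le_trans _ _ (complex.Re (\tr H))).
    rewrite trM /= (bigD1 j) //= (bigD1 i) //= -addrA lerDl addr_ge0 ?sumr_ge0 //.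
      by move=> *; exact: sqr_ge0.
    by move=> *; apply: sumr_ge0 => *; exact: sqr_ge0.
  have -> : n%:R * sigma_max M ^+ 2 = \sum_(l <- r) sigma_max M ^+ 2.
    by rewrite big_const_seq count_predT sr iter_addr_0 mulr_natl.
  rewrite trE raddf_sum /= !big_seq.
  by apply: ler_sum => l; rewrite rH => /sM[].
move=> h; rewrite -(@ler_pXn2r _ 2) ?nnegrE ?normc_ge0 ?mulr_ge0 //.
apply: le_trans h _; rewrite exprMn ler_wpM2r ?sqr_ge0 // -natrX ler_nat.
by rewrite leq_pmulr.
Qed.

Lemma mxl1_le_sigma_max m n (M : 'M[C]_(m, n)) :
  mxl1 M <= (m * n * n)%:R * sigma_max M.
Proof.
apply: (@le_trans _ _ (\sum_(i < m) \sum_(j < n) (n%:R * sigma_max M))).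
  by do 2![apply: ler_sum => ? _]; exact: normc_le_sigma_max.
by rewrite !sumr_const !card_ord -mulrnA -[leLHS]mulr_natl mulrA -natrM (mulnC n m).
Qed.

End Sigma.

(** * Entrywise convergence *)

Section Entrywise.
Context {R : realType} {T : Type} (F : set_system T) {FF : Filter F}.

Lemma cvg_sum (I : finType) (f : I -> T -> R) (l : I -> R) :
  (forall i, f i t @[t --> F] --> l i) ->
  \sum_i f i t @[t --> F] --> \sum_i l i.
Proof.
move=> fl; elim: (index_enum I) => [|i r IH].
  by rewrite big_nil; under eq_fun do rewrite big_nil; exact: cvg_cst.
by rewrite big_cons; under eq_fun do rewrite big_cons; exact: cvgD (fl i) IH.
Qed.

Definition mxcvg a b (M : T -> 'M[R]_(a, b)) (L : 'M[R]_(a, b)) :=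
  forall i j, M t i j @[t --> F] --> L i j.

Lemma cvg_mxcvg a b (M : T -> 'M[R]_(a, b)) (L : 'M[R]_(a, b)) :
  M t @[t --> F] --> L -> mxcvg M L.
Proof.
move=> ML i j.
exact: (cvg_comp _ (fun N : 'M[R]_(a, b) => N i j) ML (@coord_continuous _ _ _ i j L)).
Qed.

Lemma mxcvg_cst a b (L : 'M[R]_(a, b)) : mxcvg (fun=> L) L.
Proof. by move=> i j; exact: cvg_cst. Qed.

Lemma mxcvgD a b (M N : T -> 'M[R]_(a, b)) L P :
  mxcvg M L -> mxcvg N P -> mxcvg (fun t => M t + N t) (L + P).
Proof.
move=> ML NP i j; rewrite mxE; under eq_fun do rewrite mxE.
exact: cvgD (ML i j) (NP i j).
Qed.

Lemma mxcvgM a b c (M : T -> 'M[R]_(a, b)) (N : T -> 'M[R]_(b, c)) L P :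
  mxcvg M L -> mxcvg N P -> mxcvg (fun t => M t *m N t) (L *m P).
Proof.
move=> ML NP i j; rewrite mxE; under eq_fun do rewrite mxE.
by apply: cvg_sum => k; exact: cvgM (ML i k) (NP k j).
Qed.

Lemma mxcvg_block a1 a2 b1 b2 (M1 : T -> 'M[R]_(a1, b1)) (M2 : T -> 'M[R]_(a1, b2))
    (M3 : T -> 'M[R]_(a2, b1)) (M4 : T -> 'M[R]_(a2, b2)) L1 L2 L3 L4 :
  mxcvg M1 L1 -> mxcvg M2 L2 -> mxcvg M3 L3 -> mxcvg M4 L4 ->
  mxcvg (fun t => block_mx (M1 t) (M2 t) (M3 t) (M4 t)) (block_mx L1 L2 L3 L4).
Proof.
move=> h1 h2 h3 h4 i j; case: (split_ordP i) => k ->; case: (split_ordP j) => l ->.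
- by rewrite block_mxEul; under eq_fun do rewrite block_mxEul; exact: h1.
- by rewrite block_mxEur; under eq_fun do rewrite block_mxEur; exact: h2.
- by rewrite block_mxEdl; under eq_fun do rewrite block_mxEdl; exact: h3.
- by rewrite block_mxEdr; under eq_fun do rewrite block_mxEdr; exact: h4.
Qed.

(** [s] stands for any of the four block projections: a map that reads its
entries off fixed rows [f] and columns [g]. *)
Lemma mxcvg_sub a b c d (f : 'I_c -> 'I_a) (g : 'I_d -> 'I_b) (M : T -> 'M[R]_(a, b)) L
    (s : 'M[R]_(a, b) -> 'M[R]_(c, d)) :
  (forall N i j, s N i j = N (f i) (g j)) -> mxcvg M L -> mxcvg (fun t => s (M t)) (s L).
Proof.
by move=> sE ML i j; rewrite sE; under eq_fun do rewrite sE; exact: ML.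
Qed.

Lemma mxcvg_mxl1 a b (M : T -> 'M[R]_(a, b)) L :
  mxcvg M L -> mxl1 (complexmx (M t - L)) @[t --> F] --> 0.
Proof.
move=> ML; under eq_fun do rewrite mxl1_complexmx.
have Z : \sum_(i < a) \sum_(j < b) (0 : R) = 0.
  by rewrite big1 // => i _; rewrite big1.
suff : \sum_i \sum_j `|(M t - L) i j| @[t --> F] --> \sum_(i < a) \sum_(j < b) (0 : R).
  by rewrite Z.
apply: cvg_sum => i; apply: cvg_sum => j.
under eq_fun do rewrite !mxE.
apply/norm_cvg0P.
rewrite -(subrr (L i j)); apply: cvgB; [exact: ML|exact: cvg_cst].
Qed.

End Entrywise.

(** * Divergence of the transfer matrix at a limit eigenvalue *)

Section Divergence.
Context {R : realType}.
Local Notation C := R[i].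

Lemma resolvent_unit n (A : 'M[C]_n) z : ~~ eigenvalue A z -> z%:M - A \in unitmx.
Proof.
have [r [_ _ rA detE]] := det_eigenvalues A.
rewrite unitmxE unitfE detE -rA; apply: contra => /eqP/eqP.
by rewrite prodf_seq_eq0 => /hasP[l lr]; rewrite /= subr_eq0 => /eqP->.
Qed.

(** By contradiction, [Tg] below bounds the transfer matrix by [g].  The bound
[e] on the errors makes the one-sided inverses at the limit accurate up to
[2^-1] at [t]; [h] and [f] then bound [H (z - A)^-1] and [(z - A)^-1], and the
eigenvector contradicts the second bound as soon as [A t] is within
[(f + 1)^-1] of [A0]. *)
Lemma transfer_diverges T (F : set_system T) {FF : Filter F} n m p
  (A : T -> 'M[R]_n) (B : T -> 'M[R]_(n, m)) (H : T -> 'M[R]_(p, n))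
  (D : T -> 'M[R]_(p, m)) A0 B0 H0 D0 z :
  mxl1 (complexmx (A t - A0)) @[t --> F] --> 0 ->
  mxl1 (complexmx (B t - B0)) @[t --> F] --> 0 ->
  mxl1 (complexmx (H t - H0)) @[t --> F] --> 0 ->
  mxl1 (complexmx (D t - D0)) @[t --> F] --> 0 ->
  (forall v : 'rV_n, v *m complexmx A0 = z *: v -> v *m complexmx B0 = 0 -> v = 0) ->
  (forall v : 'cV_n, complexmx A0 *m v = z *: v -> complexmx H0 *m v = 0 -> v = 0) ->
  (\forall t \near F, ~~ eigenvalue (complexmx (A t)) z) ->
  eigenvalue (complexmx A0) z ->
  forall g, \forall t \near F, g <= mxl1 (transfer (A t) (B t) (H t) (D t) z).
Proof.
move=> cA cB cH cD /right_inverse[X' [Y' XY']] /left_inverse[X [Y XY]] nz.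
move=> /eigenvalueP[v vA /mxl1_gt0 v0] g.
have [X0 Y0 X'0 Y'0] : [/\ 0 <= mxl1 X, 0 <= mxl1 Y, 0 <= mxl1 X' & 0 <= mxl1 Y'].
  by split; exact: mxl1_ge0.
pose e := (2 * (mxl1 X + mxl1 Y + mxl1 X' + mxl1 Y' + 1))^-1.
have e0 : 0 < e by rewrite invr_gt0; lra.
have eE : e * (mxl1 X + mxl1 Y + mxl1 X' + mxl1 Y' + 1) = 2^-1.
  by rewrite /e invfM -mulrA mulVf ?mulr1 // gt_eqF //; lra.
pose h := 2 * ((mxl1 (complexmx H0) + 1) * mxl1 X' +
               (`|g| + (mxl1 (complexmx D0) + 1)) * mxl1 Y').
pose f := 2 * (mxl1 X + mxl1 Y * h).
have h0 : 0 <= h.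
  rewrite mulr_ge0 // addr_ge0 // mulr_ge0 // ?addr_ge0 ?mxl1_ge0 //.
have f0 : 0 <= f by rewrite mulr_ge0 // addr_ge0 // mulr_ge0.
have f1 : 0 < (f + 1)^-1 by rewrite invr_gt0 ltr_wpDl.
near=> t.
have At1 : mxl1 (complexmx (A t - A0)) < e by near: t; exact: (cvgr_lt _ cA).
have At2 : mxl1 (complexmx (A t - A0)) < (f + 1)^-1 by near: t; exact: (cvgr_lt _ cA).
have Bt1 : mxl1 (complexmx (B t - B0)) < e by near: t; exact: (cvgr_lt _ cB).
have Ht1 : mxl1 (complexmx (H t - H0)) < e by near: t; exact: (cvgr_lt _ cH).
have Ht2 : mxl1 (complexmx (H t - H0)) < 1 by near: t; exact: (cvgr_lt _ cH).
have Dt1 : mxl1 (complexmx (D t - D0)) < 1 by near: t; exact: (cvgr_lt _ cD).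
have Mu : z%:M - complexmx (A t) \in unitmx.
  by apply: resolvent_unit; near: t.
rewrite leNgt; apply/negP => Tg.
set M := z%:M - complexmx (A t) in Mu.
have ME : M = z%:M - complexmx A0 - complexmx (A t - A0).
  by rewrite /M complexmxB opprB addrA addrNK.
have small (x y r q : R) : 0 <= x -> 0 <= y -> r < e -> q < e ->
    x + y <= mxl1 X + mxl1 Y + mxl1 X' + mxl1 Y' -> x * r + y * q <= 2^-1.
  move=> x0 y0 re qe xy; rewrite -eE; apply: (@le_trans _ _ (x * e + y * e)).
    by apply: lerD; apply: ler_wpM2l => //; exact: ltW.
  by rewrite -mulrDl mulrC ler_wpM2l ?(ltW e0) //; lra.
have E1 : mxl1 (X *m M + Y *m complexmx (H t) - 1%:M) <= 2^-1.
  have -> : X *m M + Y *m complexmx (H t) - 1%:M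
      = X *m - complexmx (A t - A0) + Y *m complexmx (H t - H0).
    rewrite -XY ME !complexmxB !(mulmxN, mulmxBr).
    by apply/matrixP => i j; rewrite !mxE; ring.
  apply: le_trans (mxl1D _ _) _.
  apply: le_trans (lerD (mxl1M _ _) (mxl1M _ _)) _; rewrite mxl1N.
  by apply: small => //; lra.
have E2 : mxl1 (M *m X' + complexmx (B t) *m Y' - 1%:M) <= 2^-1.
  have -> : M *m X' + complexmx (B t) *m Y' - 1%:M
      = - complexmx (A t - A0) *m X' + complexmx (B t - B0) *m Y'.
    rewrite -XY' ME !complexmxB !(mulNmx, mulmxBl).
    by apply/matrixP => i j; rewrite !mxE; ring.
  apply: le_trans (mxl1D _ _) _.
  apply: le_trans (lerD (mxl1M _ _) (mxl1M _ _)) _; rewrite mxl1N.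
  by rewrite mulrC [X in _ + X]mulrC; apply: small => //; lra.
have hH : mxl1 (complexmx (H t)) <= mxl1 (complexmx H0) + 1.
  rewrite -(subrK H0 (H t)) complexmxD addrC.
  by apply: le_trans (mxl1D _ _) _; rewrite lerD2l ltW.
have hD : mxl1 (complexmx (D t)) <= mxl1 (complexmx D0) + 1.
  rewrite -(subrK D0 (D t)) complexmxD addrC.
  by apply: le_trans (mxl1D _ _) _; rewrite lerD2l ltW.
have hG : mxl1 (complexmx (H t) *m invmx M *m complexmx (B t)) <=
    `|g| + (mxl1 (complexmx D0) + 1).
  rewrite -[_ *m _](addrK (complexmx (D t))); apply: le_trans (mxl1D _ _) (lerD _ _).
    by apply: le_trans (ltW Tg) (ler_norm _).
  by rewrite mxl1N.
have hF : mxl1 (complexmx (H t) *m invmx M) <= h.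
  apply: le_trans (mxl1_mul_invmx_le (complexmx (H t)) Mu E2) _.
  by rewrite ler_wpM2l // lerD // ler_wpM2r.
have FM : mxl1 (invmx M) <= f.
  apply: le_trans (mxl1_invmx_le Mu E1) _.
  by rewrite ler_wpM2l // lerD2l ler_wpM2l.
have vE : v = v *m - complexmx (A t - A0) *m invmx M.
  rewrite -[LHS](mulmxK Mu) ME mulmxBr mulmxN mulmxBr vA mul_mx_scalar subrr.
  by rewrite sub0r.
have : mxl1 v <= mxl1 v * (mxl1 (complexmx (A t - A0)) * mxl1 (invmx M)).
  rewrite {1}vE mulrA -(mxl1N (complexmx _)).
  apply: le_trans (mxl1M _ _) _.
  by apply: ler_wpM2r; [exact: mxl1_ge0|exact: mxl1M].
rewrite ler_pMr //; apply/negP; rewrite -ltNge.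
apply: (@le_lt_trans _ _ ((f + 1)^-1 * f)).
  by apply: ler_pM; rewrite ?mxl1_ge0 // ltW.
by rewrite mulrC ltr_pdivrMr ?ltr_wpDl // mul1r ltrDl.
Unshelve. all: by end_near.
Qed.

End Divergence.

(** * The closed loop along a convergent family of policies *)

Section ClosedLoopCvg.
Context {R : realType} {n m p : nat} {T : Type} (F : set_system T) {FF : Filter F}.
Variables (A : 'M[R]_n) (B : 'M[R]_(n, m)) (D : 'M[R]_(p, n)).
Variables (Q W : 'M[R]_n) (Rw : 'M[R]_m) (V : 'M[R]_p).
Variables (K : T -> 'M[R]_(m + n, p + n)) (L : 'M[R]_(m + n, p + n)).
Hypothesis KL : mxcvg F K L.

Let cD : mxcvg F (fun t => policyD (K t)) (policyD L).
Proof.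
by apply: (mxcvg_sub (f := lshift n) (g := lshift n)) KL => N i j; rewrite !mxE.
Qed.

Let cC : mxcvg F (fun t => policyC (K t)) (policyC L).
Proof.
by apply: (mxcvg_sub (f := lshift n) (g := @rshift p n)) KL => N i j; rewrite !mxE.
Qed.

Let cB : mxcvg F (fun t => policyB (K t)) (policyB L).
Proof.
by apply: (mxcvg_sub (f := @rshift m n) (g := lshift n)) KL => N i j; rewrite !mxE.
Qed.

Let cA : mxcvg F (fun t => policyA (K t)) (policyA L).
Proof.
by apply: (mxcvg_sub (f := @rshift m n) (g := @rshift p n)) KL => N i j; rewrite !mxE.
Qed.

Lemma Acl_cvg : mxcvg F (fun t => Acl A B D (K t)) (Acl A B D L).
Proof.
by apply: mxcvg_block => //; do ?apply: mxcvgD; do ?apply: mxcvgM => //; exact: mxcvg_cst.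
Qed.

Lemma Bcl_cvg : mxcvg F (fun t => Bcl B W V (K t)) (Bcl B W V L).
Proof.
by apply: mxcvg_block => //; do ?apply: mxcvgM => //; exact: mxcvg_cst.
Qed.

Lemma Ccl_cvg : mxcvg F (fun t => Ccl D Q Rw (K t)) (Ccl D Q Rw L).
Proof.
by apply: mxcvg_block => //; do ?apply: mxcvgM => //; exact: mxcvg_cst.
Qed.

Lemma Dcl_cvg : mxcvg F (fun t => Dcl Rw V (K t)) (Dcl Rw V L).
Proof.
by apply: mxcvg_block => //; do ?apply: mxcvgM => //; exact: mxcvg_cst.
Qed.

End ClosedLoopCvg.

Arguments Acl_cvg {R n m p T F FF} A B D {K L} _.
Arguments Bcl_cvg {R n m p T F FF} B W V {K L} _.
Arguments Ccl_cvg {R n m p T F FF} D Q Rw {K L} _.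
Arguments Dcl_cvg {R n m p T F FF} Rw V {K L} _.

(** Applying [stable_near] to the neighborhoods of [Kinf] shows that a
stabilizing [Kinf] would be interior; applying [Re_eigenvalue_limit] along the
sequence [K] puts the resulting eigenvalue in the closed left half plane. *)
Lemma boundary_eigenvalue (R : realType) (n m p : nat)
  (A : 'M[R]_n) (B : 'M[R]_(n, m)) (C : 'M[R]_(p, n))
  (K : nat -> 'M[R]_(m + n, p + n)) (Kinf : 'M[R]_(m + n, p + n)) :
  (forall t, stabilizing A B C (K t)) ->
  boundary (stabilizing A B C) Kinf -> K t @[t --> \oo] --> Kinf ->
  exists w : R, eigenvalue (complexmx (Acl A B C Kinf)) (Complex 0 w).
Proof.
move=> Kst [_ Kni] Kcv.
have [z Az z0] : exists2 z, eigenvalue (complexmx (Acl A B C Kinf)) z &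
    ~ complex.Re z < 0.
  apply: contra_notP Kni => /forall2NP st.
  have : stable (Acl A B C Kinf) by move=> z Az; case: (st z) => // /contrapT.
  have nb : mxcvg (nbhs Kinf) id Kinf by apply: cvg_mxcvg; exact: cvg_id.
  by move=> st0; exact: (stable_near (mxcvg_mxl1 (Acl_cvg A B C nb)) st0).
have z1 : complex.Re z <= 0.
  apply: Re_eigenvalue_limit (mxcvg_mxl1 (Acl_cvg A B C (cvg_mxcvg Kcv))) _ Az.
  by apply: nearW.
exists (complex.Im z); suff <- : z = Complex 0 (complex.Im z) by [].
have : complex.Re z = 0 by apply/eqP; rewrite eq_le z1 leNgt; apply/negP.
by case: (z) => a b /= ->.
Qed.

(** * Divergence of the cost *)

Theorem theorem5p1 (R : realType) (n m p : nat)
  (n_ge1 : (1 <= n)%N) (m_ge1 : (1 <= m)%N) (p_ge1 : (1 <= p)%N)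
  (A : 'M[R]_n) (B : 'M[R]_(n, m)) (C : 'M[R]_(p, n))
  (Q W : 'M[R]_n) (Rw : 'M[R]_m) (V : 'M[R]_p)
  (Q_psd : psdmx Q) (W_psd : psdmx W) (Rw_pd : pdmx Rw) (V_pd : pdmx V)
  (AB_ctrb : controllable A B) (AW_ctrb : controllable A (sqrtmx W))
  (CA_obsv : observable C A) (QA_obsv : observable (sqrtmx Q) A)
  (K : nat -> 'M[R]_(m + n, p + n)) (Kinf : 'M[R]_(m + n, p + n))
  (K_stabilizing : forall t, stabilizing A B C (K t))
  (Kinf_boundary : boundary (stabilizing A B C) Kinf)
  (K_cvg : K t @[t --> \oo] --> Kinf)
  (Kinf_minimal : minimal_policy Kinf) :
  Jinf A B C Q W Rw V (K t) @[t --> \oo] --> +oo%E.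
Proof.
have [w Aw] := boundary_eigenvalue K_stabilizing Kinf_boundary K_cvg.
have KK : mxcvg \oo K Kinf by apply: cvg_mxcvg K_cvg.
have [ctrK obsK] := Kinf_minimal.
apply/cvgeyPge => g.
pose N : R := ((n + m) * (n + p) * (n + p))%:R.
have N0 : 0 < N by rewrite ltr0n !muln_gt0 !addn_gt0 n_ge1.
have T_large : \forall t \near \oo, N * g <= mxl1 (transfer (Acl A B C (K t))
    (Bcl B W V (K t)) (Ccl C Q Rw (K t)) (Dcl Rw V (K t)) (Complex 0 w)).
  apply: transfer_diverges (mxcvg_mxl1 (Acl_cvg A B C KK)) (mxcvg_mxl1 (Bcl_cvg B W V KK))
    (mxcvg_mxl1 (Ccl_cvg C Q Rw KK)) (mxcvg_mxl1 (Dcl_cvg Rw V KK)) _ _ _ Aw _.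
  - by move=> v; apply: closed_loop_controllable AW_ctrb (sqrtmx_unit V_pd) ctrK.
  - by move=> v; apply: closed_loop_observable QA_obsv (sqrtmx_unit Rw_pd) obsK.
  - by apply: nearW => t; apply/negP => /K_stabilizing; rewrite ltxx.
apply: filterS T_large => t; set G := transfer _ _ _ _ _ => NG.
have gG : g <= sigma_max G.
  by rewrite -(ler_pM2l N0); exact: le_trans NG (mxl1_le_sigma_max _).
apply: (@le_trans _ _ (sigma_max G)%:E); first by rewrite lee_fin.
by apply: ereal_sup_ubound; exists w.
Qed.
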